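(* Let $G$ be a unicyclic graph, different from a cycle, whose unique cycle $C_t$ has $t\ge 3$ vertices. If $|\tau(G)|\ge 2$, then $|\tau(G)|\le pd_s(G)\le |\tau(G)|+2$.
   Context: Graphs are finite, simple, connected; $d_G$ is shortest-path distance, $d_G(x,W)=\min\{d_G(x,w):w\in W\}$. A set $W$ strongly resolves different vertices $x,y\notin W$ if $d_G(x,W)=d_G(x,y)+d_G(y,W)$ or $d_G(y,W)=d_G(y,x)+d_G(x,W)$. A vertex partition $\Pi$ is a strong resolving partition if every two different vertices in the same set of $\Pi$ are strongly resolved by some set of $\Pi$; $pd_s(G)$ is the minimum cardinality of such a partition. $\tau(G)$ denotes the set of end-vertices (vertices of degree one) of $G$. *)

(* Defs.v *)
From mathcomp Require Import all_boot.

Set Implicit Arguments.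
Unset Strict Implicit.
Unset Printing Implicit Defensive.

Section Graphs.

Variables (T : finType) (e : rel T).

Definition simple_graph : Prop := symmetric e /\ irreflexive e.

Definition connected_graph : Prop :=
  0 < #|T| /\ forall x y : T, connect e x y.

(* The least length of a walk from x to y; the value is #|T|, larger than any
   distance, when there is none. *)
Definition gdist (x y : T) : nat :=
  find (fun n => [exists p : n.-tuple T, path e x p && (last x p == y)])
       (iota 0 #|T|).

(* The default #|T| is reached only if W is empty or unreachable from x; the
   blocks of a partition are nonempty. *)
Definition set_dist (x : T) (W : {set T}) : nat :=
  \big[minn/#|T|]_(w in W) gdist x w.

Definition strongly_resolves (W : {set T}) (x y : T) : bool :=
  [&& x != y, x \notin W, y \notin W &
      (set_dist x W == gdist x y + set_dist y W)
      || (set_dist y W == gdist y x + set_dist x W)].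

Definition strong_resolving_partition (P : {set {set T}}) : bool :=
  partition P [set: T] &&
  [forall A in P, forall x in A, forall y in A,
     (x != y) ==> [exists W in P, strongly_resolves W x y]].

Lemma ex_strong_resolving_partition :
  exists k, [exists P, strong_resolving_partition P && (#|P| == k)].
Proof.
pose P := [set [set x] | x : T].
exists #|P|; apply/existsP; exists P; rewrite eqxx andbT.
apply/andP; split.
  apply/and3P; split.
  - apply/eqP/setP=> x; rewrite inE; apply/bigcupP.
    by exists [set x]; rewrite ?set11 //; apply: imset_f.
  - apply/trivIsetP=> _ _ /imsetP[x _ ->] /imsetP[y _ ->] xy.
    rewrite disjoints1 inE; apply: contraNneq xy => ->; exact: eqxx.
  - by apply/imsetP=> -[x _ /setP/(_ x)]; rewrite !inE eqxx.
apply/forall_inP=> _ /imsetP[z _ ->]; apply/forall_inP=> x /set1P ->.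
by apply/forall_inP=> y /set1P ->; rewrite eqxx.
Qed.

Definition pd_s : nat := ex_minn ex_strong_resolving_partition.

Definition end_vertices : {set T} := [set x | #|[set y | e x y]| == 1].

Definition graph_cycle (c : seq T) : bool := (2 < size c) && ucycleb e c.

(* The sequences representing a given cycle (all rotations and reversals) are
   exactly those with the same edge set, so cycles are compared through it. *)
Definition cycle_edges (c : seq T) : {set {set T}} :=
  [set [set x; next c x] | x in c].

Definition unique_cycle (c : seq T) : Prop :=
  graph_cycle c /\
  forall c', graph_cycle c' -> cycle_edges c' = cycle_edges c.

Definition unicyclic : Prop :=
  connected_graph /\ exists c, unique_cycle c.

Definition is_cycle_graph : Prop :=
  exists c, [/\ graph_cycle c, forall x, x \in c
    & forall x y, e x y -> [set x; y] \in cycle_edges c].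

End Graphs.

(* Main.v *)
Require Import Defs.
From mathcomp Require Import all_boot.

(** Lower bound: an end-vertex is never interior to a geodesic, so no set
    strongly resolves two end-vertices, and these lie in different blocks.

    Upper bound: root a breadth-first spanning tree at an end-vertex [r]. The
    block [{r}] strongly resolves any two vertices on a common branch, because
    branches are geodesics to [r]; so it suffices to split the other vertices
    into as many pieces of branches as the tree has leaves besides [r]. The
    cycle closed by a non-tree edge contains no other non-tree edge, hence there
    is at most one such edge, and a leaf of the tree is an end-vertex of the
    graph or one of the two ends of that edge. *)

Set Implicit Arguments.
Unset Strict Implicit.
Unset Printing Implicit Defensive.

(** A repetition-free [te]-path from [x] to [y], closed by the edge from [y] back to [x]: all its
    edges but the closing one belong to [te]. *)
Lemma cycle_through_non_tree_edge (T : finType) (e te : rel T) (x y : T) :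
    symmetric te -> subrel te e -> connect te x y ->
    e y x -> x != y -> ~~ te x y ->
  exists c, [/\ graph_cycle e c, [set x; y] \in cycle_edges c
    & forall a b, ~~ te a b -> [set a; b] \in cycle_edges c ->
      [set a; b] = [set x; y]].
Proof.
move=> te_sym te_e /connectP[p0 ep0 ly] eyx xy nte_xy.
move: ly; case/shortenP: ep0 => p tep up _ ly.
have last_next : next (x :: p) y = x.
  (* The index of [y] in [x :: p] is [size p], past the end of [p], so [nth] returns its default
     [x]. *)
  rewrite next_nth ly mem_last -[RHS](@nth_default _ x p (size p)) //.
  by rewrite -(index_last up).
have next_te z : z \in x :: p ->
    te z (next (x :: p) z) \/ z = y.
  (* Allowing every step out of [y] makes the whole of [x :: p] a cycle, so that [next_cycle]
     applies to each vertex. *)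
  pose te' : rel T := [rel a b | te a b || (a == y)].
  have cyc : cycle te' (x :: p).
    rewrite /= rcons_path -ly {2}/te' /= eqxx orbT andbT.
    by apply: sub_path tep => a b; rewrite /te' /= => ->.
  by move/(next_cycle cyc) => /orP[|/eqP]; [left|right].
exists (x :: p); split.
- rewrite /graph_cycle /ucycleb up andbT /= rcons_path -ly eyx.
  rewrite (sub_path te_e tep) !andbT.
  case: p {up last_next next_te} tep ly => [|z [|z' p]] //= tep ly.
    by rewrite ly eqxx in xy.
  by move: nte_xy; rewrite ly; case/andP: tep => ->.
- apply/imsetP; exists y; first by rewrite ly mem_last.
  by rewrite last_next setUC.
move=> a b nte_ab /imsetP[z zp eq_ab].
have [te_z|z_y] := next_te z zp; last by rewrite eq_ab z_y last_next setUC.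
case/negP: nte_ab.
move: te_z eq_ab; set z' := next _ z => te_z eq_ab.
(* Equal unordered pairs give [te a b] up to orientation; the case [a = b] forces [z = z']. *)
have: a \in [set z; z'] by rewrite -eq_ab set21.
have: b \in [set z; z'] by rewrite -eq_ab set22.
have: z \in [set a; b] by rewrite eq_ab set21.
have: z' \in [set a; b] by rewrite eq_ab set22.
move: te_z; rewrite !inE; move: z' {eq_ab zp} => z' te_z z'ab zab.
case/orP=> /eqP eq_b /orP[]/eqP eq_a; subst a b; rewrite ?orbb // in z'ab zab *.
- by rewrite -{2}(eqP z'ab).
- by rewrite te_sym.
by rewrite -{1}(eqP zab).
Qed.

(** * Distances and geodesics *)

Section Distance.

Variables (T : finType) (e : rel T).
Hypothesis Gconn : forall x y : T, connect e x y.

(** [gdist] searches only lengths below [#|T|], so the walk is first shortened to one without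
    repetitions. *)
Lemma gdist_le_size x p : path e x p -> gdist e x (last x p) <= size p.
Proof.
move=> /shortenP[q eq_q uq sub_qp].
have le_qp : size q <= size p by apply: uniq_leq_size => //; case/andP: uq.
apply: leq_trans le_qp; rewrite leqNgt; apply/negP=> /(before_find 0).
have q_lt : size q < #|T| by move/card_uniqP: uq => /= <-; exact: max_card.
rewrite nth_iota // add0n => /negbT/existsP[].
by exists (in_tuple q); rewrite eq_q /=.
Qed.

Lemma gdist_lt_card x y : gdist e x y < #|T|.
Proof.
have /connectP[p ep ->] := Gconn x y; case/shortenP: ep => q eq_q uq _.
apply: leq_ltn_trans (gdist_le_size eq_q) _.
by move/card_uniqP: uq => /= <-; exact: max_card.
Qed.

Lemma gdist_walk x y :
  exists p, [/\ path e x p, last x p = y & size p = gdist e x y].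
Proof.
have : has (fun n => [exists q : n.-tuple T, path e x q && (last x q == y)])
         (iota 0 #|T|) by rewrite has_find size_iota; exact: gdist_lt_card.
move/(nth_find 0); rewrite -/(gdist e x y) nth_iota ?gdist_lt_card // add0n.
case/existsP=> q /andP[eq_q /eqP lq].
by exists q; split=> //; rewrite size_tuple.
Qed.

Lemma gdist0 x : gdist e x x = 0.
Proof. by apply/eqP; rewrite -leqn0; exact: (@gdist_le_size x [::]). Qed.

Lemma gdist_triangle x y z : gdist e x z <= gdist e x y + gdist e y z.
Proof.
have [p [ep lp <-]] := gdist_walk x y; have [q [eq_q <- <-]] := gdist_walk y z.
by rewrite -size_cat -{1}lp -last_cat gdist_le_size // cat_path ep lp.
Qed.

Lemma gdist_edge x y : e x y -> gdist e x y <= 1.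
Proof. by move=> exy; apply: (@gdist_le_size x [:: y]); rewrite /= exy. Qed.

Lemma gdist_first_step x y : x != y ->
  exists2 z, e x z & gdist e x y = (gdist e z y).+1.
Proof.
move=> xy; have [[|z p] [/= ep lp sp]] := gdist_walk x y.
  by rewrite lp eqxx in xy.
case/andP: ep => exz ep; exists z => //; apply/eqP; rewrite eqn_leq.
rewrite -{2}sp ltnS -lp gdist_le_size // andbT.
by apply: leq_trans (gdist_triangle _ z _) _; rewrite -add1n leq_add2r gdist_edge.
Qed.

Lemma gdist_last_step x y : x != y ->
  exists2 z, e z y & gdist e x z < gdist e x y.
Proof.
move=> xy; have [p [ep lp <-]] := gdist_walk x y.
case/lastP: p ep lp => [|p z]; first by move=> _ /= lp; rewrite lp eqxx in xy.
rewrite rcons_path last_rcons size_rcons => /andP[ep ez] <-.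
by exists (last x p); rewrite ?ltnS ?gdist_le_size.
Qed.

Lemma set_dist_le x w (W : {set T}) : w \in W -> set_dist e x W <= gdist e x w.
Proof.
move=> wW; rewrite /set_dist -big_filter.
have: w \in [seq v <- index_enum T | v \in W].
  by rewrite mem_filter wW mem_index_enum.
elim: (filter _ _) => // v s IHs.
rewrite inE big_cons geq_min => /predU1P[->|/IHs->]; first by rewrite leqnn.
exact: orbT.
Qed.

Lemma set_dist_attained x (W : {set T}) : W != set0 ->
  exists2 w, w \in W & set_dist e x W = gdist e x w.
Proof.
case/set0Pn=> w0 w0W.
(* The induction must admit the default [#|T|]; it is excluded afterwards, since all distances are
   below [#|T|]. *)
have : set_dist e x W = #|T| \/
       exists2 w, w \in W & set_dist e x W = gdist e x w.
  rewrite /set_dist; elim/big_rec: _ => [|w m wW IHm]; first by left.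
  case: (leqP (gdist e x w) m) => [_|_]; last exact: IHm.
  by right; exists w.
case=> // dT; have := set_dist_le x w0W.
by rewrite dT leqNgt gdist_lt_card.
Qed.

Lemma set_dist1 x r : set_dist e x [set r] = gdist e x r.
Proof.
have [|w /set1P -> //] := @set_dist_attained x [set r].
by apply/set0Pn; exists r; rewrite set11.
Qed.

(** * End-vertices and the lower bound *)

Hypothesis Gsym : symmetric e.

Lemma end_vertex_neighbor y a b :
  y \in end_vertices e -> e y a -> e y b -> a = b.
Proof.
rewrite inE => /cards1P[z nbr_y] eya eyb.
have: a \in [set y0 | e y y0] by rewrite inE.
have: b \in [set y0 | e y y0] by rewrite inE.
by rewrite nbr_y => /set1P-> /set1P->.
Qed.

(** Entering [y] on a geodesic from [x] and leaving it towards a nearest point of [W] both use its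
    only neighbour [z]; turning at [z] already is strictly shorter. *)
Lemma end_vertex_not_between x y (W : {set T}) :
    W != set0 -> x != y -> y \notin W -> y \in end_vertices e ->
  set_dist e x W != gdist e x y + set_dist e y W.
Proof.
move=> W0 xy yW yend; have [w wW ->] := set_dist_attained y W0.
have yw : y != w by apply: contraNneq yW => ->.
have [z ezy lt_xz] := gdist_last_step xy.
have [z' eyz' ->] := gdist_first_step yw.
have eyz : e y z by rewrite Gsym.
rewrite -(end_vertex_neighbor yend eyz eyz') neq_ltn; apply/orP; left.
apply: leq_ltn_trans (set_dist_le x wW) _.
apply: leq_ltn_trans (gdist_triangle x z w) _.
by rewrite addnS ltnS leq_add2r ltnW.
Qed.

Lemma card_end_vertices_le (P : {set {set T}}) :
  strong_resolving_partition e P -> #|end_vertices e| <= #|P|.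
Proof.
case/andP=> Ppart /forall_inP resP; case/and3P: (Ppart) => /eqP covP trivP P0.
have pbP x : pblock P x \in P by rewrite pblock_mem // covP inE.
have <- : #|pblock P @: end_vertices e| = #|end_vertices e|.
  apply: card_in_imset => x y xend yend pb_xy; apply/eqP/negPn/negP=> xy.
  have xA : x \in pblock P x by rewrite mem_pblock covP inE.
  have yA : y \in pblock P x by rewrite pb_xy mem_pblock covP inE.
  move/(_ _ (pbP x))/forall_inP/(_ _ xA)/forall_inP/(_ _ yA): resP.
  rewrite xy => /exists_inP[W WP /and4P[_ xW yW]]; apply/negP.
  have W0 : W != set0 by apply: contraNneq P0 => <-.
  by rewrite negb_or !end_vertex_not_between // eq_sym.
by apply/subset_leq_card/subsetP=> _ /imsetP[x _ ->].
Qed.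

(** * Branches of a breadth-first tree and the upper bound *)

Section BranchPartition.

Variables (r : T) (parent : T -> T).
Hypothesis parent_root : parent r = r.
Hypothesis parent_dist :
  forall x, x != r -> gdist e x r = (gdist e (parent x) r).+1.
Hypothesis parent_edge : forall x, x != r -> e x (parent x).

(** The root is left out because it forms a block of its own. *)
Definition tree_leaves : {set T} :=
  [set x | (x != r) && [forall y, (parent y == x) ==> (y == r)]].

(** The conjunct [e x y] discards the loop coming from [parent r = r] when [e] is irreflexive. *)
Definition tree_edge : rel T :=
  [rel x y | e x y && ((parent x == y) || (parent y == x))].

(** Each step to the parent has length at most one and lowers the distance to [r] by one, so the
    triangle inequality is tight; at [r] the branch stays put. *)
Lemma branch_geodesic n x (y := iter n parent x) :
  gdist e x r = gdist e x y + gdist e y r.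
Proof.
rewrite {}/y; elim: n => [|n IHn] /=; first by rewrite gdist0.
set z := iter n parent x in IHn *.
have [z_r|z_r] := eqVneq z r; first by rewrite z_r parent_root -{2 3}z_r.
apply/eqP; rewrite eqn_leq gdist_triangle /= IHn (parent_dist z_r) addnS -addSn.
rewrite leq_add2r -addn1; apply: leq_trans (gdist_triangle _ z _) _.
by rewrite leq_add2l gdist_edge ?parent_edge.
Qed.

(** Passing from a vertex to a child increases the distance to [r], which is bounded by [#|T|], so
    the ascent ends at a leaf. *)
Lemma exists_tree_leaf_above v : v != r ->
  exists2 l, l \in tree_leaves & exists n, iter n parent l = v.
Proof.
move=> v_r; have [k] := ubnP (#|T| - gdist e v r).
elim: k v v_r => // k IHk v v_r; rewrite ltnS => lek.
have [v_leaf|] := boolP (v \in tree_leaves); first by exists v; [|exists 0].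
rewrite inE v_r => /forallPn[y]; rewrite negb_imply => /andP[/eqP py y_r].
have [|l lL [n ln]] := IHk y y_r.
  apply: leq_trans lek; rewrite (parent_dist y_r) py.
  by rewrite ltn_sub2l ?gdist_lt_card.
by exists l => //; exists n.+1; rewrite /= ln.
Qed.

(** Choose for every vertex other than [r] a leaf [f v] above it. Each fibre of [f] lies on a single
    branch, and there is at most one fibre per leaf. *)
Lemma branch_partition :
  exists2 P, strong_resolving_partition e P & #|P| <= #|tree_leaves|.+1.
Proof.
have leaf_ex v : exists l, v != r ->
    l \in tree_leaves /\ exists n, iter n parent l = v.
  have [->|v_r] := eqVneq v r; first by exists r; rewrite ?eqxx.
  by have [l lL ln] := exists_tree_leaf_above v_r; exists l.
have [f fP] := fin_all_exists leaf_ex.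
pose D := [set~ r]; pose Q := preim_partition f D.
have Qpart : partition Q D := preim_partitionP f D.
have Q_f A x y : A \in Q -> x \in A -> y \in A -> [/\ x != r, y != r & f x = f y].
  case/imsetP=> z zD -> /setIdP[xD /eqP fx] /setIdP[yD /eqP fy].
  by rewrite -fx -fy; move: xD yD; rewrite !inE.
have cardQ : #|Q| <= #|tree_leaves|.
  pose g (l : T) := [set y in D | l == f y].
  have /subset_leq_card/leq_trans-> // : Q \subset g @: tree_leaves.
    apply/subsetP=> _ /imsetP[x xD ->]; apply/imsetP; exists (f x) => //.
    by case: (fP x) => //; move: xD; rewrite !inE.
  exact: leq_imset_card.
exists ([set r] |: Q); last by rewrite cardsU1 -add1n leq_add ?leq_b1.
apply/andP; split.
  have -> : [set: T] = [set r] :|: D by rewrite setUCr.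
  apply: partitionU1 => //; last by rewrite disjoints1 !inE eqxx.
  by apply/set0Pn; exists r; rewrite set11.
apply/forall_inP=> A; rewrite !inE => /orP[/eqP->|AQ].
  apply/forall_inP=> x /set1P->; apply/forall_inP=> y /set1P->.
  by rewrite eqxx.
apply/forall_inP=> x xA; apply/forall_inP=> y yA; apply/implyP=> xy.
have [x_r y_r fxy] := Q_f A x y AQ xA yA.
apply/exists_inP; exists [set r]; first by rewrite !inE eqxx.
rewrite /strongly_resolves xy !inE x_r y_r !set_dist1 /=.
have [_ [i fi]] := fP x x_r; have [_ [j fj]] := fP y y_r.
(* Of two iterates of the same leaf, the later one lies on the branch from the earlier one to
   [r]. *)
rewrite -fxy in fj; case/orP: (leq_total i j) => le_ij; apply/orP; [left|right].
  by rewrite -fj -(subnK le_ij) iterD fi -branch_geodesic.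
by rewrite -fi -(subnK le_ij) iterD fj -branch_geodesic.
Qed.

Lemma tree_edge_sym : symmetric tree_edge.
Proof. by move=> x y; rewrite /tree_edge /= Gsym orbC. Qed.

Lemma tree_edge_connected x y : connect tree_edge x y.
Proof.
have to_r z : connect tree_edge z r.
  have [k] := ubnP (gdist e z r); elim: k z => // k IHk z; rewrite ltnS => lek.
  have [->|z_r] := eqVneq z r; first exact: connect0.
  apply: (@connect_trans _ _ (parent z)).
    by apply: connect1; rewrite /tree_edge /= parent_edge // eqxx.
  by apply: IHk; rewrite -(parent_dist z_r).
apply: connect_trans (to_r x) _.
by rewrite (sym_connect_sym tree_edge_sym).
Qed.

Hypothesis Girr : irreflexive e.
Variable c : seq T.
Hypothesis c_unique : unique_cycle e c.
Hypothesis r_end : r \in end_vertices e.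

(** The cycles closed by the two edges have the same edge set, by uniqueness; hence the first edge
    lies on the second cycle, whose only non-tree edge is the second one. *)
Lemma non_tree_edge_unique x y x' y' :
    e x y -> ~~ tree_edge x y -> e x' y' -> ~~ tree_edge x' y' ->
  [set x; y] = [set x'; y'].
Proof.
have fund a b : e a b -> ~~ tree_edge a b ->
    exists2 c', cycle_edges c' = cycle_edges c & [set a; b] \in cycle_edges c' /\
    forall a' b', ~~ tree_edge a' b' -> [set a'; b'] \in cycle_edges c' ->
      [set a'; b'] = [set a; b].
  move=> eab nab; have ab : a != b by apply: contraTneq eab => ->; rewrite Girr.
  have sub_te : subrel tree_edge e by move=> ? ? /andP[].
  have eba : e b a by rewrite Gsym.
  have [c' [c'cyc abc' c'P]] := cycle_through_non_tree_edge
    tree_edge_sym sub_te (tree_edge_connected a b) eba ab nab.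
  by exists c' => //; case: c_unique => _; apply.
move=> exy nxy exy' nxy'.
have [c1 c1c [xyc1 _]] := fund _ _ exy nxy.
have [c2 c2c [_ c2P]] := fund _ _ exy' nxy'.
by apply: c2P => //; rewrite c2c -c1c.
Qed.

Definition non_tree_ends : {set T} :=
  [set x | [exists y, e x y && ~~ tree_edge x y]].

Lemma card_non_tree_ends : #|non_tree_ends| <= 2.
Proof.
have [->|[x]] := set_0Vmem non_tree_ends; first by rewrite cards0.
rewrite inE => /existsP[y /andP[exy nxy]].
apply: (@leq_trans #|[set x; y]|); last by rewrite cards2; case: (x != y).
apply/subset_leq_card/subsetP=> z; rewrite inE => /existsP[w /andP[ezw nzw]].
by rewrite (non_tree_edge_unique exy nxy ezw nzw) !inE eqxx.
Qed.

(** A leaf that is not an end-vertex has a neighbour besides its parent; being childless, it is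
    joined to that neighbour by a non-tree edge. *)
Lemma tree_leaves_sub :
  tree_leaves \subset (end_vertices e :\ r) :|: non_tree_ends.
Proof.
apply/subsetP=> x; rewrite inE => /andP[x_r /forallP x_leaf].
rewrite in_setU in_setD1 x_r /=; case: (boolP (x \in end_vertices e)) => //= x_end.
have px : parent x \in [set y | e x y] by rewrite inE parent_edge.
have /subsetPn[y] : ~~ ([set y | e x y] \subset [set parent x]).
  apply: contra x_end => sub_px; rewrite inE; apply/cards1P; exists (parent x).
  by apply/eqP; rewrite eqEsubset sub_px sub1set.
rewrite !inE => exy y_px; apply/existsP; exists y.
rewrite /tree_edge /= exy /= negb_or eq_sym y_px /=; apply/negP=> /eqP py.
have /eqP y_r : y == r by apply: (implyP (x_leaf y)); apply/eqP.
by move: x_r; rewrite -py y_r parent_root eqxx.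
Qed.

(** Rooting at an end-vertex saves one: [r] counts among the end-vertices but not among the leaves,
    which leaves one less than their number, plus two. *)
Lemma card_tree_leaves : #|tree_leaves| <= #|end_vertices e|.+1.
Proof.
apply: leq_trans (subset_leq_card tree_leaves_sub) _.
apply: leq_trans (leq_card_setU _ _) _.
rewrite (cardsD1 r (end_vertices e)) r_end add1n -addn2.
by rewrite leq_add2l card_non_tree_ends.
Qed.

End BranchPartition.

Lemma exists_bfs_parent r : exists parent, [/\ parent r = r,
    forall x, x != r -> gdist e x r = (gdist e (parent x) r).+1
    & forall x, x != r -> e x (parent x)].
Proof.
pose parent x := if x == r then r else
  (* The default [r] is never taken: the first step of a geodesic to [r] is a valid choice. *)
  odflt r [pick y | e x y && (gdist e x r == (gdist e y r).+1)].
have parentP x : x != r ->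
    e x (parent x) /\ gdist e x r = (gdist e (parent x) r).+1.
  move=> x_r; rewrite /parent (negbTE x_r); case: pickP => [y /andP[? /eqP] //|].
  have [y exy dxy] := gdist_first_step x_r.
  by move/(_ y); rewrite exy dxy eqxx.
exists parent; split; first by rewrite /parent eqxx.
  by move=> x /parentP[].
by move=> x /parentP[].
Qed.

End Distance.

Theorem theorem26 (T : finType) (e : rel T) (c : seq T) (t : nat)
    (Gsimple : simple_graph e) (Gunicyclic : unicyclic e)
    (Gnot_cycle : ~ is_cycle_graph e)
    (c_cycle : unique_cycle e c) (c_size : size c = t) (t_ge3 : 3 <= t)
    (tau_ge2 : 2 <= #|end_vertices e|) :
  #|end_vertices e| <= pd_s e <= #|end_vertices e| + 2.
Proof.
have [[Gsym Girr] [[_ Gconn] _]] := (Gsimple, Gunicyclic).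
rewrite /pd_s; case: ex_minnP => k /existsP[P /andP[resP /eqP <-]] min_k.
rewrite card_end_vertices_le //=.
have /card_gt0P[r r_end] : 0 < #|end_vertices e| by apply: ltnW.
have [parent [p_root p_dist p_edge]] := exists_bfs_parent Gconn r.
have [Q resQ cardQ] := branch_partition Gconn p_root p_dist p_edge.
apply: (@leq_trans #|Q|).
  by apply: min_k; apply/existsP; exists Q; rewrite resQ eqxx.
(* One of the two extra blocks is the singleton of [r], the other comes from the leaf count. *)
rewrite addn2; apply: leq_trans cardQ _; rewrite ltnS.
exact: (card_tree_leaves Gsym p_root p_dist p_edge Girr c_cycle r_end).
Qed.
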